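(* Let $G$ be a finite, simple, connected graph on $n$ vertices with $m \le 2n-1$ edges and maximum degree $\Delta(G) \le 4$. Then $a'(G) \le 6$.
   Context: A proper edge coloring of a graph assigns colors to edges so that adjacent edges (edges sharing an endpoint) receive different colors. It is acyclic if there is no bichromatic cycle, i.e. no cycle whose edges use only two colors. The acyclic chromatic index $a'(G)$ is the minimum number of colors in an acyclic edge coloring of $G$. *)

(* Defs.v *)
From mathcomp Require Import all_boot.
Set Implicit Arguments. Unset Strict Implicit. Unset Printing Implicit Defensive.

Section Graph.
Variable T : finType.
Variable e : rel T.

Definition simple_graph : Prop := symmetric e /\ irreflexive e.

Definition edge_set : {set {set T}} :=
  [set E : {set T} | [exists x, exists y, e x y && (E == [set x; y])]].

Definition degree (x : T) : nat := #|[set y | e x y]|.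

Definition max_degree_le (d : nat) : Prop := forall x, degree x <= d.

Definition connected_graph : Prop := forall x y : T, connect e x y.

Definition proper_edge_coloring (k : nat) (c : {set T} -> nat) : Prop :=
  (forall E, E \in edge_set -> c E < k) /\
  (forall E F, E \in edge_set -> F \in edge_set -> E != F ->
     (E :&: F != set0) -> c E != c F).

Definition is_cycle (p : seq T) : Prop :=
  [/\ uniq p, 3 <= size p & cycle e p].

Definition acyclic_edge_coloring (k : nat) (c : {set T} -> nat) : Prop :=
  proper_edge_coloring k c /\
  ~ (exists (p : seq T) (a b : nat), is_cycle p /\
       forall x, x \in p -> (c [set x; next p x] == a) || (c [set x; next p x] == b)).

Definition acyclic_chromatic_index_le (k : nat) : Prop :=
  exists c : {set T} -> nat, acyclic_edge_coloring k c.
End Graph.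

(* Main.v *)
(** Connectedness and [m <= 2n - 1] make [G] 3-degenerate, so it suffices to extend
    an acyclic 6-coloring of [G - x] to a vertex [x] with at most three neighbours
    [yi].  The set [Si] of colors free at [yi] has at least 3 elements, and distinct
    colors [ci] in [Si] fail only if some [yi] and [yj] are joined by a path in the
    colors [ci], [cj]; this requires [cj] not in [Si] and [ci] not in [Sj].  If the
    [Si] meet pairwise, a choice from the pairwise intersections works.  Otherwise
    two of them, say [S1] and [S2], are complementary.  Since a bichromatic path has only
    two ends, the failure of every choice forces, for one [u] among the [yi] and two
    colors [p], [q] in [S2], all the paths in colors [a], [p] and [a], [q] with [a]
    in [S1] that start at [y2] to end at [u].  Exchanging [p] and [q] on the edges at
    [u] then breaks all these paths and makes a choice succeed. *)

Require Import Defs.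
From mathcomp Require Import all_boot.
From mathcomp Require Import perm zify.
From Stdlib Require Import Classical.

Set Implicit Arguments. Unset Strict Implicit. Unset Printing Implicit Defensive.

(** * Cycles and path ends in a symmetric relation *)

Section Relations.
Variable T : finType.
Implicit Types (r : rel T) (x y z : T).

Definition acyclic_rel r := forall p, uniq p -> 3 <= size p -> ~~ cycle r p.

Definition path_end r x := forall y z, r x y -> r x z -> y = z.

(** Deletes the vertex [x] by isolating it, so that the vertex type stays the same. *)
Definition off x r y z := [&& r y z, y != x & z != x].
Arguments off x r y z /.

Lemma off_sym x r : symmetric r -> symmetric (off x r).
Proof. by move=> rS y z /=; rewrite rS [(y != x) && _]andbC. Qed.

Lemma acyclic_sub r r' : subrel r r' -> acyclic_rel r' -> acyclic_rel r.
Proof.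
move=> sub ac p up sp; apply: contraNN (ac p up sp).
by case: p {up sp} => //= x p; apply: sub_path.
Qed.

Lemma connect_isolated r x y : x != y -> (forall z, ~~ r x z) ->
  ~~ connect r x y.
Proof.
move=> xy iso; apply/negP => /connectP [[|z p] /= pp yE].
  by rewrite yE eqxx in xy.
by case/andP: pp => rxz _; move: (iso z); rewrite rxz.
Qed.

(** A cycle through [x] leaves and re-enters it by two different neighbours, and the rest of it is a
    path between these that avoids [x]. *)
Lemma acyclic_off r x : symmetric r -> acyclic_rel (off x r) ->
  (forall s t, r x s -> r x t -> s != t -> ~~ connect (off x r) s t) ->
  acyclic_rel r.
Proof.
move=> rS ac nc p up sp; apply/negP => cp.
have [xp|xp] := boolP (x \in p); last first.
  have := ac p up sp; apply/negP; rewrite negbK.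
  apply: cycle_from_next => // y yp /=; rewrite next_cycle //=.
  by apply/andP; split; apply: contraNneq xp => <-; rewrite ?mem_next.
have [i q pE] := rot_to xp.
have := cp; rewrite -(rot_cycle i) pE.
have := up; rewrite -(rot_uniq i) pE.
have := sp; rewrite -(size_rot i) pE.
case: q {pE} => [|s [|t q]] //= _ /and3P [].
rewrite !inE !negb_or => /and3P [xs xt xq] /andP [st sq] _.
rewrite rcons_path => /and4P [rxs rst pq rlx].
have rxl : r x (last t q) by rewrite rS.
have sl : s != last t q.
  by have := mem_last t q; apply: contraTneq => <-; rewrite inE negb_or st.
move: (nc _ _ rxs rxl sl); apply/negP; rewrite negbK.
apply/connectP; exists (t :: q) => //=.
rewrite rst (eq_sym s) xs (eq_sym t) xt /=.
elim: q t xt xq pq {st sq rst rlx rxl sl} => //= z q IH t xt.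
rewrite inE negb_or => /andP [xz xq] /andP [rtz pq].
by rewrite rtz (eq_sym t) xt (eq_sym z) xz /= IH.
Qed.

(** The two paths advance in step: with degree at most 2 and the previous vertex [z] used up, one
    continuation remains. Neither path can stop first, since an end has no neighbour but [z]. *)
Lemma simple_path_end_unique r z x p q : symmetric r ->
  (forall v a b d, r v a -> r v b -> r v d -> [\/ a = b, a = d | b = d]) ->
  r z x -> path r x p -> path r x q -> uniq (z :: x :: p) ->
  uniq (z :: x :: q) ->
  path_end r (last x p) -> path_end r (last x q) -> last x p = last x q.
Proof.
move=> rS deg2; elim: p z x q => [|a p IH] z x [|b q] //= rzx.
- move=> _ /andP [rxb _] _ /andP [].
  rewrite !inE !negb_or => /and3P [_ zb _] _ ex _.
  by move: rzx; rewrite rS => rxz; rewrite (ex _ _ rxz rxb) eqxx in zb.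
- move=> /andP [rxa _] _ /andP [].
  rewrite !inE !negb_or => /and3P [_ za _] _ _ _ ex.
  by move: rzx; rewrite rS => rxz; rewrite (ex _ _ rxz rxa) eqxx in za.
move=> /andP [rxa pa] /andP [rxb qb] /andP [].
rewrite !inE !negb_or => /and3P [_ za _] ua /andP [/and3P [_ zb _] ub].
have rxz : r x z by rewrite rS.
have ab : a = b.
  case: (deg2 _ _ _ _ rxz rxa rxb) => // E.
  - by rewrite E eqxx in za.
  - by rewrite E eqxx in zb.
rewrite -{b zb rxb}ab in qb ub *.
by apply: (IH x) => //=; rewrite inE negb_or.
Qed.

(* A component of maximum degree 2 is a path or a cycle. *)
Lemma no_three_ends r x y z : symmetric r ->
  (forall v a b d, r v a -> r v b -> r v d -> [\/ a = b, a = d | b = d]) ->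
  path_end r x -> path_end r y -> path_end r z ->
  x != y -> x != z -> y != z -> connect r x y -> ~~ connect r x z.
Proof.
move=> rS deg2 ex ey ez xy xz yz /connectP [p0 pp0 yE]; apply/negP.
case/connectP=> q0 pq0 zE; move: yE zE.
case/shortenP: pp0 => p pp up _ yE; case/shortenP: pq0 => q pq uq _ zE.
case: p pp up yE => [|a p] /=; first by move=> _ _ E; rewrite E eqxx in xy.
case/andP=> rxa pa ua yE.
case: q pq uq zE => [|b q] /=; first by move=> _ _ E; rewrite E eqxx in xz.
case/andP=> rxb qb ub zE.
have ab := ex _ _ rxa rxb; rewrite -{b rxb}ab in qb ub zE.
have E : last a p = last a q.
  by apply: (simple_path_end_unique (z := x)) => //=; rewrite -?yE -?zE.
by rewrite yE zE E eqxx in yz.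
Qed.

End Relations.

Arguments off {T} x r y z /.

Notation color := 'I_6.

(** * Acyclic 6-colorings and their bichromatic paths *)

Section Coloring.
Variables (T : finType).
Implicit Types (g : rel T) (c : T -> T -> color) (a b : color).

Definition bicolored g c a b y z :=
  g y z && ((c y z == a) || (c y z == b)).
Arguments bicolored g c a b y z /.

Definition nbrs g x := [set y | g x y].

Definition free g c x : {set color} := [set a | [forall y, g x y ==> (c x y != a)]].

(** Colors sit on ordered pairs, with arbitrary symmetric values off the edges, which spares working
    with edges as sets. *)
Record acyclic_coloring g c : Prop := AcyclicColoring {
  coloring_sym : forall x y, c x y = c y x;
  coloring_proper : forall x y z, g x y -> g x z -> c x y = c x z -> y = z;
  coloring_acyclic : forall a b, acyclic_rel (bicolored g c a b) }.

Lemma freeP g c x a : reflect (forall y, g x y -> c x y != a) (a \in free g c x).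
Proof. by rewrite inE; apply: (iffP forall_inP). Qed.

Lemma card_free g c x d : #|nbrs g x| <= d -> 6 - d <= #|free g c x|.
Proof.
move=> dx; have sub : ~: free g c x \subset [set c x y | y in nbrs g x].
  apply/subsetP=> a; rewrite !inE negb_forall => /existsP [y].
  rewrite negb_imply negbK => /andP [gxy /eqP <-].
  by apply: imset_f; rewrite inE.
have := leq_trans (subset_leq_card sub) (leq_imset_card _ _).
have := cardsC (free g c x); rewrite card_ord; lia.
Qed.

Section Good.
Variables (g : rel T) (c : T -> T -> color).
Hypotheses (gS : symmetric g) (gc : acyclic_coloring g c).

Lemma bicolored_sym a b : symmetric (bicolored g c a b).
Proof. by move=> x y /=; rewrite gS (coloring_sym gc x y). Qed.

Lemma bicoloredC a b : bicolored g c a b =2 bicolored g c b a.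
Proof. by move=> x y /=; rewrite orbC. Qed.

Lemma connect_bicoloredC a b x y :
  connect (bicolored g c a b) x y = connect (bicolored g c b a) x y.
Proof. by apply: eq_connect; apply: bicoloredC. Qed.

Lemma connect_bicolored_sym a b x y :
  connect (bicolored g c a b) x y = connect (bicolored g c a b) y x.
Proof. by rewrite (sym_connect_sym (@bicolored_sym a b)). Qed.

Lemma bicolored_deg2 a b v x y z :
  bicolored g c a b v x -> bicolored g c a b v y -> bicolored g c a b v z ->
  [\/ x = y, x = z | y = z].
Proof.
have P := coloring_proper gc (x := v).
case/andP=> gx /orP [] /eqP cx; case/andP=> gy /orP [] /eqP cy;
case/andP=> gz /orP [] /eqP cz;
by [apply: Or31; apply: P => //; rewrite cx cy
   |apply: Or32; apply: P => //; rewrite cx cz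
   |apply: Or33; apply: P => //; rewrite cy cz].
Qed.

(** If one of the two colors is missing at [v], all bicolored edges there have the other, and
    properness leaves at most one. *)
Lemma free_path_end a b v : (a \in free g c v) || (b \in free g c v) ->
  path_end (bicolored g c a b) v.
Proof.
move=> /orP [] /freeP F x y /andP [gx cx] /andP [gy cy];
apply: (coloring_proper gc gx gy); move: cx cy;
by rewrite ?(negPf (F _ gx)) ?(negPf (F _ gy)) ?orbF => /eqP -> /eqP ->.
Qed.

(** Each of the three vertices is an end of its component, which has at most two. *)
Lemma three_free_vertices a b x y z :
  (a \in free g c x) || (b \in free g c x) ->
  (a \in free g c y) || (b \in free g c y) ->
  (a \in free g c z) || (b \in free g c z) ->
  x != y -> x != z -> y != z ->
  connect (bicolored g c a b) x y -> ~~ connect (bicolored g c a b) x z.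
Proof.
move=> fx fy fz; apply: no_three_ends; try exact: free_path_end.
- exact: bicolored_sym.
- exact: bicolored_deg2.
Qed.

Lemma free_both_disconnected a b x y : x != y ->
  a \in free g c x -> b \in free g c x -> ~~ connect (bicolored g c a b) x y.
Proof.
move=> xy /freeP fa /freeP fb; apply: connect_isolated => //.
move=> z /=; have [gz|//] := boolP (g x z).
by rewrite (negPf (fa _ gz)) (negPf (fb _ gz)).
Qed.

(** The last edge of the path has color [b], as [a] is free at [u]. Since [b] is free at [v], the
    penultimate vertex [w] is not [v], and the path reaches [w] by color [a]. *)
Lemma connected_first_step a b u v : u != v ->
  connect (bicolored g c a b) v u -> a \in free g c u -> b \in free g c v ->
  exists w, [/\ g u w, c u w = b,
    connect (off u (bicolored g c a b)) v w & a \notin free g c w].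
Proof.
move=> uv; rewrite connect_bicolored_sym => /connectP [p0 pp0 vE] /freeP fu /freeP fv.
move: vE; case/shortenP: pp0 => p pp up _ vE.
case: p pp up vE => [|w p] /=; first by move=> _ _ E; rewrite E eqxx in uv.
case/andP=> /andP [guw cuw] pp /andP [up uwp] vE.
have cw : c u w = b by move: cuw; rewrite (negPf (fu _ guw)) => /eqP.
exists w; split=> //.
  rewrite (sym_connect_sym (off_sym u (@bicolored_sym a b))); apply/connectP; exists p => //.
  elim: p w pp up {uwp vE guw cuw cw} => //= z p IH w /andP [rwz pp].
  rewrite !inE !negb_or => /and3P [uw uz up].
  rewrite rwz (eq_sym w) uw (eq_sym z) uz IH // inE negb_or uz //.
case: p pp up uwp vE => [|z p] /=.
  move=> _ _ _ vE; move: guw cw; rewrite -vE gS (coloring_sym gc) => gvu E.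
  by have := fv _ gvu; rewrite E eqxx.
case/andP=> /andP [gwz cwz] _; rewrite !inE !negb_or => /and3P [_ uz _] _ _.
case/orP: cwz => /eqP cwz.
  by rewrite negb_forall; apply/existsP; exists z; rewrite gwz cwz eqxx.
have E : u = z.
  apply: (coloring_proper gc (x := w)) => //; first by rewrite gS.
  by rewrite cwz (coloring_sym gc).
by rewrite E eqxx in uz.
Qed.

End Good.

(** A bichromatic cycle through [x] uses two of its edges, colored [f y] and [f z]; the rest would
    be a path in these colors from [y] to [z]. *)
Lemma extend_coloring g x c (f : T -> color) : symmetric g -> irreflexive g ->
  acyclic_coloring (off x g) c ->
  (forall y, g x y -> f y \in free (off x g) c y) ->
  (forall y z, g x y -> g x z -> y != z ->
     f y != f z /\ ~~ connect (bicolored (off x g) c (f y) (f z)) y z) ->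
  exists c', acyclic_coloring g c'.
Proof.
move=> gS gI gc fF fD.
pose c' y z := if y == x then f z else if z == x then f y else c y z.
exists c'; split.
- rewrite /c' => y z; have [->|_] := eqVneq y x; have [zx|_] := eqVneq z x; rewrite ?zx //.
  exact: (coloring_sym gc).
- move=> y z t gyz gyt; rewrite /c'; case: eqP => [yx|/eqP yx].
    subst y => E; apply/eqP; apply: contraT => zt.
    by have [/eqP] := fD _ _ gyz gyt zt.
  have fy : g y x -> f y \in free (off x g) c y by rewrite gS; apply: fF.
  have [zx|zx] := eqVneq z x; have [tx|tx] := eqVneq t x => E; subst=> //.
  + move: gyz => /[dup] /fy /freeP /(_ t).
    by rewrite /= gyt yx tx E eqxx => /(_ isT).
  + move: gyt => /[dup] /fy /freeP /(_ z).
    by rewrite /= gyz yx zx E eqxx => /(_ isT).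
  + by apply: (coloring_proper gc (x := y)); rewrite //= ?gyz ?gyt yx ?zx ?tx.
- move=> a b.
  have offE : off x (bicolored g c' a b) =2 bicolored (off x g) c a b.
    move=> y z; rewrite /= /c'.
    by case: (y == x); case: (z == x); rewrite /= ?andbF ?andbT.
  apply: (@acyclic_off _ _ x).
  + move=> y z; rewrite /= gS /c'.
    by have [->|_] := eqVneq y x; have [zx|_] := eqVneq z x; rewrite ?zx // (coloring_sym gc).
  + by apply: acyclic_sub (coloring_acyclic gc a b) => y z; rewrite offE.
  move=> s t; rewrite /= /c' eqxx (eq_connect offE).
  move=> /andP [gs cs] /andP [gt ct] st.
  have [fst nc] := fD _ _ gs gt st.
  case/orP: cs => /eqP sE; case/orP: ct => /eqP tE.
  - by rewrite sE tE eqxx in fst.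
  - by rewrite -sE -tE.
  - by rewrite connect_bicoloredC -sE -tE.
  - by rewrite sE tE eqxx in fst.
Qed.

(* Each of the two neighbours of [u] along [p] and [q] sees, besides its edge to
   [u], exactly the colors of [A]; hence exchanging [p] and [q] at [u] creates no
   conflict and no bichromatic cycle, while every path in a color of [A] and [p]
   that led from [v] to [u] now stops one step earlier, at a vertex of degree 4. *)
Lemma swap_colors g c (A : {set color}) p q u v : symmetric g ->
  acyclic_coloring g c -> (forall x, #|nbrs g x| <= 4) ->
  u != v -> #|A| = 3 -> p != q -> p \notin A -> q \notin A ->
  A \subset free g c u -> p \in free g c v -> q \in free g c v ->
  #|nbrs g v| <= 3 ->
  (forall a, a \in A -> connect (bicolored g c a p) v u) ->
  (forall a, a \in A -> connect (bicolored g c a q) v u) ->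
  exists c', [/\ acyclic_coloring g c',
    forall y, #|nbrs g y| <= 3 -> free g c' y = free g c y &
    forall a y, a \in A -> #|nbrs g y| <= 3 -> a \in free g c y -> v != y ->
      ~~ connect (bicolored g c' a p) v y].
Proof.
move=> gS gc deg4 uv A3 pq pA qA /subsetP fu fpv fqv dv conp conq.
(* All the paths enter [u] by its one edge of color [b], hence from one vertex [w]. It sees [b] and
   the three colors of [A], and degree 4 leaves room for no other. *)
have partner b : b \notin A -> b \in free g c v ->
    (forall a, a \in A -> connect (bicolored g c a b) v u) ->
    exists w, [/\ g u w, c u w = b,
      forall a, a \in A -> connect (off u (bicolored g c a b)) v w,
      forall z, g w z -> c w z \in b |: A & 3 < #|nbrs g w|].
  move=> bA fbv con.
  have [a0 a0A] : exists a, a \in A by apply/card_gt0P; rewrite A3.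
  have [w [guw cuw _ _]] := connected_first_step gS gc uv (con _ a0A) (fu _ a0A) fbv.
  have W a : a \in A -> connect (off u (bicolored g c a b)) v w /\ a \notin free g c w.
    move=> aA; have [w' [guw' cuw' cw' aw']] :=
      connected_first_step gS gc uv (con _ aA) (fu _ aA) fbv.
    by rewrite (coloring_proper gc guw guw') ?cuw.
  pose D := [set c w z | z in nbrs g w].
  have sub : b |: A \subset D.
    apply/subsetP=> a; rewrite !inE => /orP [/eqP ->|/W [_]].
      by rewrite -cuw (coloring_sym gc); apply: imset_f; rewrite inE gS.
    rewrite inE negb_forall => /existsP [z]; rewrite negb_imply negbK.
    by case/andP=> gwz /eqP <-; apply: imset_f; rewrite inE.
  have DN : #|D| <= #|nbrs g w| := leq_imset_card _ _.
  have DE : b |: A == D by rewrite eqEcard sub cardsU1 bA A3 (leq_trans DN).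
  exists w; split=> //; first by move=> a /W [].
    by move=> z gwz; rewrite (eqP DE); apply: imset_f; rewrite inE.
  by apply: leq_trans DN; rewrite -(eqP DE) cardsU1 bA A3.
have [wp [gup cup vp Ap dp]] := partner p pA fpv conp.
have [wq [guq cuq vq Aq dq]] := partner q qA fqv conq.
pose c' y z := if (y == u) || (z == u) then tperm p q (c y z) else c y z.
have tA a : a \in A -> tperm p q a = a.
  move=> aA; apply: tpermD; [apply: contraNneq pA|apply: contraNneq qA];
  by move=> ->.
have uA z : g u z -> c u z \notin A.
  by move=> guz; apply/negP => /fu /freeP /(_ _ guz); rewrite eqxx.
have special w : g u w -> c u w \in [set p; q] ->
    [/\ 3 < #|nbrs g w| & forall z, g w z -> z != u -> c w z \in A].
  move=> guw; rewrite !inE => /orP [] /eqP cuw.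
    have -> : w = wp by apply: (coloring_proper gc guw gup); rewrite cuw.
    split=> // z gz zu; move: (Ap _ gz); rewrite !inE => /orP [/eqP E|//].
    case/eqP: zu; apply: (coloring_proper gc gz); first by rewrite gS.
    by rewrite E (coloring_sym gc).
  have -> : w = wq by apply: (coloring_proper gc guw guq); rewrite cuw.
  split=> // z gz zu; move: (Aq _ gz); rewrite !inE => /orP [/eqP E|//].
  case/eqP: zu; apply: (coloring_proper gc gz); first by rewrite gS.
  by rewrite E (coloring_sym gc).
have c'u z : c' u z = tperm p q (c u z) by rewrite /c' eqxx.
have c'S y z : c' y z = c' z y by rewrite /c' orbC (coloring_sym gc).
have c'D y z : y != u -> z != u -> c' y z = c y z.
  by rewrite /c' => /negPf -> /negPf ->.
have plain y : g y u -> c y u \notin [set p; q] -> c' y u = c y u.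
  rewrite c'S c'u (coloring_sym gc) => _; rewrite !inE negb_or => /andP [np nq].
  by apply: tpermD; rewrite eq_sym.
(* If the edge from [y] to [u] was recolored, the other colors at [y] lie in [A], which the exchange
   fixes and which is free at [u]. *)
have proper' y z t : g y z -> g y t -> c' y z = c' y t -> y != u -> z = u -> z = t.
  move=> gyz gyt E yu zu; subst z; have [-> //|tu] := eqVneq t u.
  have [sp|nsp] := boolP (c y u \in [set p; q]); last first.
    by move: E; rewrite plain // (c'D _ _ yu tu); apply: (coloring_proper gc).
  have guy : g u y by rewrite gS.
  rewrite (coloring_sym gc) in sp; have [_ /(_ _ gyt tu) cA] := special _ guy sp.
  move: E; rewrite (c'D _ _ yu tu) c'S c'u => E.
  have E' : c u y = c y t by apply: (perm_inj (s := tperm p q)); rewrite (tA _ cA).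
  by rewrite -E' (negPf (uA _ guy)) in cA.
have off' a b : off u (bicolored g c' a b) =2 off u (bicolored g c a b).
  move=> y z /=; have [->|yu] := eqVneq y u; first by rewrite /= !andbF.
  by have [->|zu] := eqVneq z u; rewrite /= ?andbF // c'D.
have gc' : acyclic_coloring g c'.
  split=> //.
    move=> y z t gyz gyt E; have [yu|yu] := eqVneq y u.
      subst y; apply: (coloring_proper gc gyz gyt); apply: (perm_inj (s := tperm p q)).
      by rewrite -!c'u.
    have [zu|zu] := eqVneq z u; first exact: (proper' y).
    have [tu|tu] := eqVneq t u; first by symmetry; apply: (proper' y).
    by apply: (coloring_proper gc gyz gyt); rewrite -!c'D.
  move=> a b; have bS : symmetric (bicolored g c' a b).
    by move=> y z /=; rewrite gS c'S.
  apply: (acyclic_off (x := u)) => //.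
    apply: acyclic_sub (coloring_acyclic gc a b) => y z; rewrite off'.
    by case/andP.
  (* [a] and [b] are the new colors of the edges to [s] and [t], hence outside [A]; but away from
     [u] the vertex [s] sees only [A], so no path leaves it. *)
  have key s t : bicolored g c' a b u s -> bicolored g c' a b u t -> s != t ->
      c u s \in [set p; q] -> ~~ connect (off u (bicolored g c' a b)) s t.
    move=> /andP [gus cs] /andP [gut ct] st cus; rewrite (eq_connect (off' _ _)).
    apply: connect_isolated => //.
    move=> z /=; apply/negP => /andP [/andP [gsz csz] /andP [su zu]].
    have [_ /(_ _ gsz zu) szA] := special _ gus cus.
    have tcA w : g u w -> c' u w \notin A.
      move=> /uA; rewrite c'u; case: tpermP => // ->.
    have cst : c' u s != c' u t.
      rewrite !c'u (inj_eq perm_inj); apply: contraNneq st => E.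
      by apply/eqP; apply: (coloring_proper gc gus gut).
    move: (tcA _ gus) (tcA _ gut) cst.
    by case/orP: cs => /eqP ->; case/orP: ct => /eqP ->; rewrite ?eqxx //;
       case/orP: csz => /eqP <-; rewrite szA.
  move=> s t rs rt st.
  have [cs|ns] := boolP (c u s \in [set p; q]); first exact: key.
  rewrite (sym_connect_sym (off_sym u bS)).
  have [ct|nt] := boolP (c u t \in [set p; q]); first by apply: key; rewrite // eq_sym.
  case/andP: rs => gus _; case/andP: rt => gut _.
  (* There is only one color outside [A], [p] and [q]. *)
  have : #|[set p; q; c u s; c u t] :|: A| <= 6 by rewrite -[X in _ <= X]card_ord max_card.
  have cst : c u s != c u t by apply: contraNneq st => /(coloring_proper gc gus gut) ->.
  move: ns nt; rewrite !inE !negb_or => /andP [sp sq] /andP [tp tq].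
  have -> : [set p; q; c u s; c u t] :|: A = p |: (q |: (c u s |: (c u t |: A))).
    by rewrite -!setUA.
  rewrite !cardsU1 !inE !negb_or pq A3 pA qA !(eq_sym p) !(eq_sym q) sp sq tp tq cst.
  by rewrite (uA _ gus) (uA _ gut).
(* At [u] the colors [p] and [q] both occur and merely trade places. Any other vertex of degree at
   most 3 is not one of the partners, so it keeps its colors. *)
have ends y : #|nbrs g y| <= 3 -> free g c' y = free g c y.
  move=> dy; apply/setP=> a; have [->|yu] := eqVneq y u.
    have nf w b : g u w -> c u w = b -> b \notin free g c u.
      by move=> gw cw; apply/negP => /freeP /(_ _ gw); rewrite cw eqxx.
    have nf' w b : g u w -> c' u w = b -> b \notin free g c' u.
      by move=> gw cw; apply/negP => /freeP /(_ _ gw); rewrite cw eqxx.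
    have [->|ap] := eqVneq a p.
      by rewrite (negPf (nf _ _ gup cup)) (negPf (nf' _ _ guq _)) // c'u cuq tpermR.
    have [->|aq] := eqVneq a q.
      by rewrite (negPf (nf _ _ guq cuq)) (negPf (nf' _ _ gup _)) // c'u cup tpermL.
    have ta : tperm p q a = a by apply: tpermD; rewrite eq_sym.
    have E z : (c' u z == a) = (c u z == a) by rewrite c'u -{1}ta (inj_eq perm_inj).
    by apply/freeP/freeP => F z gz; move: (F _ gz); rewrite E.
  suff E z : g y z -> c' y z = c y z.
    by apply/freeP/freeP => F z gz; move: (F _ gz); rewrite E.
  move=> gz; have [zu|zu] := eqVneq z u; last exact: c'D.
  subst z; apply: plain => //; apply/negP; rewrite (coloring_sym gc) => cy.
  have guy : g u y by rewrite gS.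
  by have [] := special y guy cy; rewrite ltnNge dy.
exists c'; split=> // a y aA dy fay vy.
have vwp : v != wp.
  by apply: contraTneq dp => <-; rewrite -leqNgt.
(* Now [wp] misses [p], so [v] and [wp] are the two ends of their component and no third end [y]
   fits. *)
apply: (three_free_vertices gS gc' (y := wp)) => //.
- by rewrite ends // fpv orbT.
- apply/orP; right; apply/freeP => z gz; have [->|zu] := eqVneq z u.
    by rewrite c'S c'u cup tpermL eq_sym.
  have [|_ /(_ _ gz zu) zA] := special wp gup; first by rewrite cup !inE eqxx.
  have wu : wp != u by apply: contraTneq zA => E; move: gz; rewrite E => /uA.
  by rewrite c'D //; apply: contraNneq pA => <-.
- by rewrite ends // fay.
- by apply: contraTneq dp => ->; rewrite -leqNgt.
- have := vp _ aA; rewrite -(eq_connect (off' _ _)).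
  by apply: connect_sub => s t /andP [st _]; apply: connect1.
Qed.

End Coloring.

(** * Extending a coloring to a vertex with at most three neighbours *)

Section Step.
Variables (T : finType) (g : rel T) (x : T).
Hypotheses (gS : symmetric g) (gI : irreflexive g).
Hypothesis deg4 : forall y, #|nbrs g y| <= 4.

Let g0 := off x g.
Let colorable := exists c, acyclic_coloring g c.

(* The [yi] need not all be neighbours of [x]: when [x] has only two neighbours,
   [x] itself, which is isolated in [g0], can play the role of the third. *)
Definition attached y1 y2 y3 :=
  [/\ forall z, g x z -> [|| z == y1, z == y2 | z == y3],
      [/\ y1 != y2, y1 != y3 & y2 != y3] &
      [/\ #|nbrs g0 y1| <= 3, #|nbrs g0 y2| <= 3 & #|nbrs g0 y3| <= 3]].

Lemma attached_swap12 y1 y2 y3 : attached y1 y2 y3 -> attached y2 y1 y3.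
Proof.
case=> cov [n12 n13 n23] [d1 d2 d3]; split=> //; last by split=> //; rewrite eq_sym.
by move=> z /cov; rewrite orbCA.
Qed.

Lemma attached_swap23 y1 y2 y3 : attached y1 y2 y3 -> attached y1 y3 y2.
Proof.
case=> cov [n12 n13 n23] [d1 d2 d3]; split=> //; last by split=> //; rewrite eq_sym.
by move=> z /cov; rewrite [(z == y2) || _]orbC.
Qed.

Let g0S : symmetric g0. Proof. exact: off_sym. Qed.

Let deg0 y : #|nbrs g0 y| <= 4.
Proof.
apply: leq_trans (deg4 y); apply: subset_leq_card; apply/subsetP => z.
by rewrite !inE => /andP [].
Qed.

Section Attached.
Variables (c : T -> T -> color) (y1 y2 y3 : T).
Hypotheses (gc : acyclic_coloring g0 c) (att : attached y1 y2 y3).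

Let S1 := free g0 c y1.
Let S2 := free g0 c y2.
Let S3 := free g0 c y3.

Lemma attach_colors c1 c2 c3 : c1 \in S1 -> c2 \in S2 -> c3 \in S3 ->
  c1 != c2 -> c1 != c3 -> c2 != c3 ->
  ~~ connect (bicolored g0 c c1 c2) y2 y1 ->
  ~~ connect (bicolored g0 c c3 c2) y2 y3 ->
  ~~ connect (bicolored g0 c c1 c3) y1 y3 -> colorable.
Proof.
case: att => cov [n12 n13 n23] _ f1 f2 f3 c12 c13 c23 p12 p23 p13.
pose f z := if z == y1 then c1 else if z == y2 then c2 else c3.
have f1E : f y1 = c1 by rewrite /f eqxx.
have f2E : f y2 = c2 by rewrite /f eqxx eq_sym (negPf n12).
have f3E : f y3 = c3 by rewrite /f !(eq_sym y3) (negPf n13) (negPf n23).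
apply: (extend_coloring (f := f) gS gI gc).
  by move=> y /cov /or3P [] /eqP ->; rewrite ?f1E ?f2E ?f3E.
move=> y z /cov /or3P [] /eqP -> /cov /or3P [] /eqP ->;
  rewrite ?f1E ?f2E ?f3E ?eqxx // => _; split=> //; try (by rewrite eq_sym).
- by rewrite (connect_bicolored_sym g0S gc).
- by rewrite connect_bicoloredC.
- by rewrite connect_bicoloredC.
- by rewrite connect_bicoloredC (connect_bicolored_sym g0S gc).
- by rewrite (connect_bicolored_sym g0S gc).
Qed.

(** One of the two vertices misses both colors, so no path in them leaves it. *)
Lemma free_shared_disconnected a b y z : y != z ->
  a \in free g0 c y -> b \in free g0 c z ->
  (a \in free g0 c z) || (b \in free g0 c y) ->
  ~~ connect (bicolored g0 c a b) y z.
Proof.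
move=> yz fa fb /orP [faz|fby]; last exact: free_both_disconnected.
rewrite (connect_bicolored_sym g0S gc); apply: free_both_disconnected => //.
by rewrite eq_sym.
Qed.

(** [y2] gets [a], [y1] gets [b], and [y3] any third color [d] of [S3]: in each pair of the [yi] one
    vertex misses both colors. *)
Lemma attach_common a b : a \in S1 -> a \in S2 -> a \in S3 ->
  b != a -> b \in S1 -> b \in S3 -> colorable.
Proof.
case: (att) => _ [n12 n13 n23] [_ _ d3] a1 a2 a3 ba b1 b3.
have /card_gt0P [d] : 0 < #|S3 :\ a :\ b|.
  move: (card_free c d3); rewrite -/S3 (cardsD1 a S3) (cardsD1 b (S3 :\ a)).
  by rewrite a3 in_setD1 ba b3.
rewrite !in_setD1 => /and3P [db da d3'].
apply: (@attach_colors b a d) => //; rewrite 1?eq_sym //.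
- rewrite connect_bicoloredC; apply: free_shared_disconnected => //.
    by rewrite eq_sym.
  by rewrite a1.
- rewrite connect_bicoloredC; apply: free_shared_disconnected => //.
  by rewrite a3.
- by apply: free_shared_disconnected => //; rewrite b3.
Qed.

(** Each vertex takes a color that is also free at the next one in the cyclic order [y1], [y2],
    [y3], so no pair fails. *)
Lemma attach_cyclic a b d : a \in S1 -> a \in S2 -> b \in S2 -> b \in S3 ->
  d \in S3 -> d \in S1 -> a != b -> a != d -> b != d -> colorable.
Proof.
case: (att) => _ [n12 n13 n23] _ a1 a2 b2 b3 d3 d1 ab ad bd.
apply: (@attach_colors a b d) => //.
- rewrite connect_bicoloredC; apply: free_shared_disconnected => //.
    by rewrite eq_sym.
  by rewrite a2 orbT.
- rewrite connect_bicoloredC; apply: free_shared_disconnected => //.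
  by rewrite b3.
- by apply: free_shared_disconnected => //; rewrite d1 orbT.
Qed.

End Attached.

(** * Two vertices with complementary sets of free colors *)

Section Disjoint.
Variables (c : T -> T -> color) (y1 y2 y3 : T).
Hypotheses (gc : acyclic_coloring g0 c) (att : attached y1 y2 y3).

Let S1 := free g0 c y1.
Let S2 := free g0 c y2.
Let S3 := free g0 c y3.

Hypothesis dis : S1 :&: S2 = set0.

Lemma disjoint_free : S2 = ~: S1 /\ #|S1| = 3 /\ #|S2| = 3.
Proof.
case: att => _ _ [d1 d2 _].
have := card_free c d1; have := card_free c d2; rewrite -/S1 -/S2.
have := cardsUI S1 S2; rewrite dis cards0.
have : #|S1 :|: S2| <= 6 by rewrite -[X in _ <= X]card_ord max_card.
have : #|S1| + #|~: S1| = 6 by rewrite cardsC card_ord.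
move=> HC HU HI H2 H1.
have E : #|S1| = 3 /\ #|S2| = 3 by lia.
split=> //; apply/eqP; rewrite eqEcard -disjoints_subset disjoint_sym -setI_eq0 dis eqxx.
lia.
Qed.

(** For every color of [S1] and every color of [S2], some choice can fail only by a path in these
    colors from [y2] to [y1]. So [y1] is the vertex [u] of the exchange, with [p] and [q] the colors
    of [S2] other than [b]. *)
Lemma attach_disjoint_two_one a1 a2 b : a1 != a2 -> a1 \in S1 -> a1 \in S3 ->
  a2 \in S1 -> a2 \in S3 -> b \in S2 -> b \in S3 -> colorable.
Proof.
case: (att) => _ [n12 n13 n23] [d1 d2 d3] a12 a11 a13 a21 a23 b2 b3.
have [S2E [S13 S23]] := disjoint_free.
have n21 : y2 != y1 by rewrite eq_sym.
have S12 a b' : a \in S1 -> b' \in S2 -> a != b'.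
  by rewrite S2E in_setC => aS; apply: contraNneq => <-.
have b1 : b \notin S1 by rewrite -in_setC -S2E.
apply: NNPP => nC.
(* Choose [a], [b], [ai] for [y1], [y2], [y3]: [b] is free at [y3] and [ai] at [y1], so only the
   pair [y1], [y2] can fail. *)
have link_b a : a \in S1 -> connect (bicolored g0 c a b) y2 y1.
  move=> aS; apply: contraT => nl; case: nC.
  have [ai [ai1 ai3 aai]] : exists ai, [/\ ai \in S1, ai \in S3 & a != ai].
    by have [->|?] := eqVneq a a1; [exists a2|exists a1].
  apply: (attach_colors gc att (c1 := a) (c2 := b) (c3 := ai)) => //; try exact: S12.
  - by rewrite eq_sym S12.
  - rewrite connect_bicoloredC; apply: (free_shared_disconnected gc) => //.
    by rewrite b3.
  - by apply: (free_shared_disconnected gc) => //; rewrite ai1 orbT.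
(* Choose [a], [b'], [b]: the path in [a], [b] from [y1] ends at [y2] by [link_b], so it cannot end
   at [y3]. *)
have link a b' : a \in S1 -> b' \in S2 :\ b -> connect (bicolored g0 c a b') y2 y1.
  rewrite in_setD1 => aS /andP [bb' b'2]; apply: contraT => nl; case: nC.
  apply: (attach_colors gc att (c1 := a) (c2 := b') (c3 := b)) => //; try exact: S12.
  - by rewrite connect_bicoloredC; apply: (free_shared_disconnected gc); rewrite // b2 orbT.
  - apply: (three_free_vertices g0S gc (y := y2)); rewrite -/S1 -/S2 -/S3 ?aS ?b2 ?b3 ?orbT //.
    by rewrite (connect_bicolored_sym g0S gc) link_b.
have /card_gt1P [p [q [pS qS pq]]] : 1 < #|S2 :\ b|.
  by move: S23; rewrite (cardsD1 b) b2 add1n => -[->].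
move: (pS) (qS); rewrite !in_setD1 => /andP [pb p2] /andP [qb q2].
have [c' [gc' fE nl]] : exists c', [/\ acyclic_coloring g0 c',
    forall y, #|nbrs g0 y| <= 3 -> free g0 c' y = free g0 c y &
    forall a y, a \in S1 -> #|nbrs g0 y| <= 3 -> a \in free g0 c y -> y2 != y ->
      ~~ connect (bicolored g0 c' a p) y2 y].
  apply: (swap_colors (A := S1) (q := q) (u := y1)) => //.
  - by rewrite -in_setC -S2E.
  - by rewrite -in_setC -S2E.
  - by move=> a aS; apply: link.
  - by move=> a aS; apply: link.
apply: nC; apply: (attach_colors gc' att (c1 := a1) (c2 := p) (c3 := b)); rewrite ?fE //.
- exact: S12.
- exact: S12.
- exact: nl.
- rewrite connect_bicoloredC; apply: (free_shared_disconnected gc'); rewrite ?fE //.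
  by rewrite b2 orbT.
- by apply: (free_shared_disconnected gc'); rewrite ?fE // a13.
Qed.

(** If every choice fails, then for fixed [b] in [S2] the paths in [b] and a color of [S1] all lead
    from [y2] to [y1], or all to [y3]. Of the three colors of [S2], two share this end, which serves
    as [u]. *)
Lemma attach_disjoint_contained : S1 \subset S3 -> colorable.
Proof.
case: (att) => _ [n12 n13 n23] [d1 d2 d3] /subsetP S13.
have [S2E [c1 c2]] := disjoint_free.
have n21 : y2 != y1 by rewrite eq_sym.
have S12 a b : a \in S1 -> b \in S2 -> a != b.
  by rewrite S2E in_setC => aS; apply: contraNneq => <-.
have S21 b : b \in S2 -> b \notin S1 by rewrite S2E in_setC.
apply: NNPP => nC.
pose full y b := [forall a in S1, connect (bicolored g0 c a b) y2 y].
have full13 b : b \in S2 -> full y1 b || full y3 b.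
  (* Choose [a], [b], [a']: both [a] and [a'] are free at [y1] and at [y3], so a failure involves
     [y2]. *)
  move=> b2; have alt a a' : a \in S1 -> a' \in S1 -> a != a' ->
      connect (bicolored g0 c a b) y2 y1 || connect (bicolored g0 c a' b) y2 y3.
    move=> aS a'S aa'; apply: contraT; rewrite negb_or => /andP [na na'].
    case: nC; apply: (attach_colors gc att (c1 := a) (c2 := b) (c3 := a')) => //.
    - exact: S13.
    - exact: S12.
    - by rewrite eq_sym S12.
    - by apply: (free_shared_disconnected gc); rewrite // ?S13 // -/S1 ?aS ?a'S ?orbT.
  have excl a : a \in S1 -> connect (bicolored g0 c a b) y2 y3 ->
      ~~ connect (bicolored g0 c a b) y2 y1.
    move=> aS; apply: (three_free_vertices g0S gc) => //.
    - by rewrite -/S2 b2 orbT.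
    - by rewrite -/S3 S13.
    - by rewrite -/S1 aS.
    - by rewrite eq_sym.
  rewrite /full; case: forall_inP => //= F.
  apply/forall_inP => a aS; apply: contraT => na3; case: F => a' a'S.
  have [<-|aa'] := eqVneq a a'; last first.
    by have := alt a' a a'S aS; rewrite eq_sym (negPf na3) orbF; apply.
  (* Here the paths in [a] reach neither [y1] nor [y3]. Pairing [a] with [d] both ways would make
     those in [d] reach both, against [excl]. *)
  have /card_gt0P [d] : 0 < #|S1 :\ a| by move: c1; rewrite (cardsD1 a) aS add1n => -[->].
  rewrite in_setD1 => /andP [da dS].
  have nd1 : connect (bicolored g0 c d b) y2 y1.
    by have := alt d a dS aS da; rewrite (negPf na3) orbF.
  have : ~~ connect (bicolored g0 c d b) y2 y3.
    by apply: contraTN nd1; apply: excl.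
  by have := alt a d aS dS; rewrite eq_sym => /(_ da) /orP [//|->].
have finish u p q : u \in [:: y1; y3] -> p \in S2 -> q \in S2 -> p != q ->
    full u p -> full u q -> False.
  move=> u13 p2 q2 pq /forall_inP up /forall_inP uq.
  have [c' [gc' fE nl]] : exists c', [/\ acyclic_coloring g0 c',
      forall y, #|nbrs g0 y| <= 3 -> free g0 c' y = free g0 c y &
      forall a y, a \in S1 -> #|nbrs g0 y| <= 3 -> a \in free g0 c y -> y2 != y ->
        ~~ connect (bicolored g0 c' a p) y2 y].
    apply: (swap_colors (A := S1) (q := q) (u := u)); rewrite ?S21 //.
    - by move: u13; rewrite !inE => /orP [] /eqP -> //; rewrite eq_sym.
    - move: u13; rewrite !inE => /orP [] /eqP -> //; exact/subsetP.
  have /card_gt1P [a [a' [aS a'S aa']]] : 1 < #|S1| by rewrite c1.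
  apply: nC; apply: (attach_colors gc' att (c1 := a) (c2 := p) (c3 := a')); rewrite ?fE //.
  - exact: S13.
  - exact: S12.
  - by rewrite eq_sym S12.
  - exact: nl.
  - by apply: nl => //; apply: S13.
  - by apply: (free_shared_disconnected gc'); rewrite ?fE // ?S13 // -/S1 ?aS ?a'S ?orbT.
pose B1 := [set b in S2 | full y1 b].
have [B1big|B1small] := ltnP 1 #|B1|.
  have /card_gt1P [p [q [pB qB pq]]] := B1big.
  have [/setIdP [p2 fp] /setIdP [q2 fq]] := conj pB qB.
  by apply: (finish y1 p q); rewrite // !inE eqxx ?orbT.
have /card_gt1P [p [q [pB qB pq]]] : 1 < #|S2 :\: B1|.
  have := cardsID B1 S2; rewrite c2; have := subset_leq_card (subsetIr S2 B1); lia.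
have fy3 b : b \in S2 :\: B1 -> b \in S2 /\ full y3 b.
  rewrite in_setD => /andP [nB b2]; split=> //.
  have := full13 _ b2; case: (boolP (full y1 b)) => //= f1 _.
  by case/negP: nB; apply/setIdP.
have [p2 fp] := fy3 _ pB; have [q2 fq] := fy3 _ qB.
by apply: (finish y3 p q); rewrite // !inE eqxx ?orbT.
Qed.

End Disjoint.

(** The free set of [y3] has at least three colors, split between the complementary free sets of
    [y1] and [y2]: it contains one of these, or meets one in two colors and the other in at least
    one. *)
Lemma attach_disjoint c y1 y2 y3 : acyclic_coloring g0 c -> attached y1 y2 y3 ->
  free g0 c y1 :&: free g0 c y2 = set0 -> colorable.
Proof.
move=> gc att dis; have [S2E [c1 c2]] := disjoint_free att dis.
have att' := attached_swap12 att.
have dis' : free g0 c y2 :&: free g0 c y1 = set0 by rewrite setIC.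
have c3 : 3 <= #|free g0 c y3| by case: att => _ _ [_ _] /(card_free c).
set S3 := free g0 c y3 in c3.
have c3E : #|S3 :&: free g0 c y1| + #|S3 :&: free g0 c y2| = #|S3|.
  by rewrite S2E -setDE cardsID.
have contained (S : {set color}) : #|S| = 3 -> 2 < #|S3 :&: S| -> S \subset S3.
  move=> cS lt; have /eqP <- : S3 :&: S == S by rewrite eqEcard subsetIr cS.
  exact: subsetIl.
have [l1|g1] := ltnP 2 #|S3 :&: free g0 c y1|.
  exact: (attach_disjoint_contained gc att dis (contained _ c1 l1)).
have [l2|g2] := ltnP 2 #|S3 :&: free g0 c y2|.
  exact: (attach_disjoint_contained gc att' dis' (contained _ c2 l2)).
have [l|h] := ltnP 1 #|S3 :&: free g0 c y1|.
  have /card_gt1P [a1 [a2 [/setIP [a13 a11] /setIP [a23 a21] a12]]] := l.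
  have /card_gt0P [b /setIP [b3 b2]] : 0 < #|S3 :&: free g0 c y2| by lia.
  exact: (attach_disjoint_two_one gc att dis a12 a11 a13 a21 a23 b2 b3).
have /card_gt1P [a1 [a2 [/setIP [a13 a11] /setIP [a23 a21] a12]]] :
  1 < #|S3 :&: free g0 c y2| by lia.
have /card_gt0P [b /setIP [b3 b2]] : 0 < #|S3 :&: free g0 c y1| by lia.
exact: (attach_disjoint_two_one gc att' dis' a12 a11 a13 a21 a23 b2 b3).
Qed.

(** If the free sets meet pairwise without a common color, the pairwise shared colors are distinct
    and give a cyclic choice. A common color [k] works together with any second color shared by two
    of the sets. *)
Lemma attach_three c y1 y2 y3 : acyclic_coloring g0 c -> attached y1 y2 y3 ->
  colorable.
Proof.
move=> gc att.
have att12 := attached_swap12 att; have att23 := attached_swap23 att.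
have att13 := attached_swap23 att12.
set S1 := free g0 c y1; set S2 := free g0 c y2; set S3 := free g0 c y3.
have [d12|/set0Pn [a /setIP [a1 a2]]] := eqVneq (S1 :&: S2) set0.
  exact: (attach_disjoint gc att d12).
have [d13|/set0Pn [d /setIP [d1 d3]]] := eqVneq (S1 :&: S3) set0.
  exact: (attach_disjoint gc att23 d13).
have [d23|/set0Pn [b /setIP [b2 b3]]] := eqVneq (S2 :&: S3) set0.
  exact: (attach_disjoint gc att13 d23).
have [E|/set0Pn [k /setIP [/setIP [k1 k2] k3]]] := eqVneq (S1 :&: S2 :&: S3) set0.
  have nE k : k \in S1 -> k \in S2 -> k \in S3 -> False.
    move=> k1 k2 k3; have := in_set0 k;
    by rewrite -E !in_setI k1 k2 k3.
  apply: (attach_cyclic gc att a1 a2 b2 b3 d3 d1).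
  - by apply/eqP => ab; subst b; apply: (nE a).
  - by apply/eqP => ad; subst d; apply: (nE a).
  - by apply/eqP => bd; subst d; apply: (nE b).
have [E12|/set0Pn [b']] := eqVneq (S1 :&: S2 :\ k) set0; last first.
  rewrite in_setD1 => /andP [bk /setIP [b1' b2']].
  exact: (attach_common gc att23 k1 k3 k2 bk b1' b2').
have [E13|/set0Pn [b']] := eqVneq (S1 :&: S3 :\ k) set0; last first.
  rewrite in_setD1 => /andP [bk /setIP [b1' b3']].
  exact: (attach_common gc att k1 k2 k3 bk b1' b3').
have [E23|/set0Pn [b']] := eqVneq (S2 :&: S3 :\ k) set0; last first.
  rewrite in_setD1 => /andP [bk /setIP [b2' b3']].
  exact: (attach_common gc att12 k2 k1 k3 bk b2' b3').
(* Three disjoint sets [Si :\ k] of size at least 2 do not fit into 5 colors. *)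
case: att => _ _ [dg1 dg2 dg3]; exfalso.
have := card_free c dg1; have := card_free c dg2; have := card_free c dg3.
rewrite -/S1 -/S2 -/S3 => f3 f2 f1.
have k12 : #|S1 :&: S2| = 1 by rewrite (cardsD1 k) E12 cards0 inE k1 k2.
have k13 : #|S1 :&: S3| = 1 by rewrite (cardsD1 k) E13 cards0 inE k1 k3.
have k23 : #|S2 :&: S3| = 1 by rewrite (cardsD1 k) E23 cards0 inE k2 k3.
have k123 : 0 < #|(S1 :&: S3) :&: (S2 :&: S3)|.
  by apply/card_gt0P; exists k; rewrite !in_setI k1 k2 k3.
have U12 := cardsUI S1 S2; have U123 := cardsUI (S1 :|: S2) S3.
have := cardsUI (S1 :&: S3) (S2 :&: S3); rewrite -setIUl => U3.
have : #|S1 :|: S2 :|: S3| <= 6 by rewrite -[X in _ <= X]card_ord max_card.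
clear -f1 f2 f3 k12 k13 k23 k123 U12 U123 U3; lia.
Qed.

Lemma extend_to_vertex c : acyclic_coloring g0 c -> #|nbrs g x| <= 3 -> colorable.
Proof.
move=> gc dx; have xN y : g x y -> x != y.
  by apply: contraTneq => <-; rewrite gI.
have d3 y : g x y -> #|nbrs g0 y| <= 3.
  move=> gxy; rewrite -ltnS; apply: leq_trans (deg4 y).
  apply: proper_card; apply/properP; split.
    by apply/subsetP => z; rewrite !inE => /andP [].
  by exists x; [rewrite inE gS|rewrite inE /g0 /= eqxx !andbF].
have dx0 : #|nbrs g0 x| <= 3.
  by rewrite (_ : nbrs g0 x = set0) ?cards0 //; apply/setP=> z; rewrite !inE /g0 /= eqxx andbF.
have memN z : (z \in enum (nbrs g x)) = g x z by rewrite mem_enum inE.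
have := enum_uniq (mem (nbrs g x)); have := dx; rewrite cardE.
case: (enum (nbrs g x)) memN => [|y1 [|y2 [|y3 [|//]]]] memN _.
- move=> _; apply: (extend_coloring (f := fun=> ord0) gS gI gc) => [y|y z];
  by rewrite -memN.
- move=> _; have g1 : g x y1 by rewrite -memN inE.
  have /card_gt0P [a fa] : 0 < #|free g0 c y1| by apply: leq_trans (card_free c (d3 _ g1)).
  apply: (extend_coloring (f := fun=> a) gS gI gc) => [y|y z].
    by rewrite -memN mem_seq1 => /eqP ->.
  by rewrite -!memN !mem_seq1 => /eqP -> /eqP ->; rewrite eqxx.
- rewrite /= !inE andbT => n12.
  have g1 : g x y1 by rewrite -memN !inE eqxx.
  have g2 : g x y2 by rewrite -memN !inE eqxx orbT.
  apply: (attach_three gc (y1 := y1) (y2 := y2) (y3 := x)); split.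
  + by move=> z; rewrite -memN !inE => /orP [] ->; rewrite ?orbT.
  + by split=> //; rewrite eq_sym xN.
  + by split=> //; apply: d3.
rewrite /= !inE negb_or !andbT => /andP [/andP [n12 n13] n23].
apply: (attach_three gc (y1 := y1) (y2 := y2) (y3 := y3)); split=> //.
  by move=> z; rewrite -memN !inE.
by split; apply: d3; rewrite -memN !inE eqxx ?orbT.
Qed.

End Step.

(** * Edge counting, degeneracy and the passage to colorings of edge sets *)

Section Main.
Variables (T : finType) (e : rel T).
Hypotheses (eS : symmetric e) (eI : irreflexive e).

Lemma edge_pair (x y u v : T) : x != y -> [set x; y] = [set u; v] ->
  (x = u /\ y = v) \/ (x = v /\ y = u).
Proof.
move=> xy E; have := set21 x y; have := set22 x y; rewrite E !inE.
case/orP=> /eqP yE; case/orP=> /eqP xE; subst; auto; by rewrite eqxx in xy.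
Qed.

(** Ordered pairs of adjacent vertices are grouped by their edge, and each edge has at most two
    orientations. *)
Lemma sum_degree_le : \sum_x degree e x <= #|edge_set e| * 2.
Proof.
pose h (p : T * T) := [set p.1; p.2].
rewrite (eq_bigr (fun x => \sum_(y | e x y) 1)); last first.
  by move=> x _; rewrite /degree -sum1dep_card.
rewrite pair_big_dep /= (partition_big h (mem (edge_set e))) /=; last first.
  move=> [x y] /= exy; rewrite inE; apply/existsP; exists x; apply/existsP; exists y.
  by rewrite exy eqxx.
rewrite -sum_nat_const; apply: leq_sum => E.
rewrite inE => /existsP [u /existsP [v /andP [euv /eqP ->]]].
rewrite sum1dep_card.
apply: (leq_trans (n := #|[set (u, v); (v, u)]|)); last by rewrite cards2; case: eqP.
apply: subset_leq_card; apply/subsetP => -[x y]; rewrite !inE /h /= => /andP [exy /eqP E'].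
have xy : x != y by apply: contraTneq exy => ->; rewrite eI.
by case: (edge_pair xy E') => [[-> ->]|[-> ->]]; rewrite eqxx ?orbT.
Qed.

Hypothesis deg4 : forall x, #|nbrs e x| <= 4.

Definition induced (A : {set T}) y z := [&& e y z, y \in A & z \in A].

(** Induction on the size of [A]: a vertex with at most three neighbours in [A] is removed, the rest
    colored, and the vertex put back by [extend_to_vertex]. *)
Lemma degenerate_colorable :
  (forall A : {set T}, A != set0 -> exists2 x, x \in A & #|nbrs (induced A) x| <= 3) ->
  exists c, acyclic_coloring e c.
Proof.
move=> degen.
suff H n (A : {set T}) : #|A| = n -> exists c, acyclic_coloring (induced A) c.
  have [c gc] := H _ [set: T] erefl; exists c.
  have E y z : induced [set: T] y z = e y z by rewrite /induced !inE !andbT.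
  case: gc => cS cP cA; split=> //.
    by move=> y z t; rewrite -!E; apply: cP.
  by move=> a b; apply: acyclic_sub (cA a b) => y z; rewrite /bicolored E.
elim: n A => [|n IH] A cA.
  exists (fun _ _ => ord0); move/eqP: cA; rewrite cards_eq0 => /eqP ->.
  split=> //.
    by move=> y z t; rewrite /induced inE andbF.
  move=> a b [|y [|z p]] //= _ _.
  by apply/negP => /andP [/andP [/and3P [_]]]; rewrite inE.
have A0 : A != set0 by rewrite -card_gt0 cA.
have [x xA dx] := degen A A0.
have [c gc] : exists c, acyclic_coloring (induced (A :\ x)) c.
  by apply: IH; move: cA; rewrite (cardsD1 x) xA add1n => -[].
have offE : off x (induced A) =2 induced (A :\ x).
  move=> y z; rewrite /= /induced !inE.
  by case: (y == x); case: (z == x); rewrite /= ?andbF ?andbT.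
apply: (@extend_to_vertex _ (induced A) x _ _ _ c) => //.
- by move=> y z; rewrite /induced eS [(y \in A) && _]andbC.
- by move=> y; rewrite /induced eI.
- move=> y; apply: leq_trans (deg4 y); apply: subset_leq_card; apply/subsetP => z.
  by rewrite !inE => /andP [].
case: gc => cS cP cA'; split=> //.
  by move=> y z t; rewrite !offE; apply: cP.
by move=> a b; apply: acyclic_sub (cA' a b) => y z; rewrite /bicolored offE.
Qed.

Lemma acyclic_coloring_index c : acyclic_coloring e c ->
  acyclic_chromatic_index_le e 6.
Proof.
move=> [cS cP cA].
(* An arbitrary orientation of the edge is picked, harmless since [c] is symmetric; sets that are
   not edges get the default 0. *)
pose C (E : {set T}) : nat :=
  if [pick p : T * T | e p.1 p.2 && (E == [set p.1; p.2])] is Some p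
  then c p.1 p.2 else 0.
have CE x y : e x y -> C [set x; y] = c x y.
  move=> exy; rewrite /C; case: pickP => [[u v] /= /andP [euv /eqP E]|/(_ (x, y))].
    have xy : x != y by apply: contraTneq exy => ->; rewrite eI.
    by case: (edge_pair xy E) => [[-> ->]|[-> ->]] //; rewrite cS.
  by rewrite /= exy eqxx.
have edgeP E : E \in edge_set e -> exists x y, e x y /\ E = [set x; y].
  by rewrite inE => /existsP [x /existsP [y /andP [exy /eqP ->]]]; exists x, y.
exists C; split; first split.
- by move=> E /edgeP [x [y [exy ->]]]; rewrite CE.
- move=> E F /edgeP [x [y [exy ->]]] /edgeP [u [v [euv ->]]] EF.
  case/set0Pn=> w; rewrite in_setI => /andP [wE wF].
  have at_w s t : e s t -> w \in [set s; t] -> exists2 k, e w k & [set s; t] = [set w; k].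
    move=> est; rewrite !inE => /orP [] /eqP ->; first by exists t.
    by exists s; rewrite 1?eS // setUC.
  have [k ewk E1] := at_w _ _ exy wE; have [l ewl E2] := at_w _ _ euv wF.
  rewrite E1 E2 !CE // in EF *; apply: contraNneq EF => /val_inj.
  by move=> /(cP _ _ _ ewk ewl) ->.
case=> p [a [b [[up sp cp] pab]]].
have [a' [b' H]] : exists a' b' : color, forall x, x \in p ->
    (c x (next p x) == a') || (c x (next p x) == b').
  (* [a] or [b] may lie outside the palette, where [inord] gives a default; only values that occur
     on the cycle matter, and those are preserved. *)
  exists (inord a), (inord b) => x xp; have := pab _ xp; rewrite CE ?next_cycle //.
  by move=> /orP [] /eqP <-; rewrite inord_val eqxx ?orbT.
have := cA a' b' p up sp; apply/negP; rewrite negbK.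
by apply: cycle_from_next => // x xp; rewrite /bicolored next_cycle ?H.
Qed.

End Main.

Theorem theorem1 (T : finType) (e : rel T) :
  simple_graph e -> connected_graph e ->
  #|edge_set e| <= 2 * #|T| - 1 ->
  max_degree_le e 4 ->
  acyclic_chromatic_index_le e 6.
Proof.
move=> [eS eI] con edges deg4.
have [c] : exists c, acyclic_coloring e c; last exact: acyclic_coloring_index.
apply: degenerate_colorable => // A A0.
have [AT|nAT] := eqVneq A [set: T].
  have [x dx] : exists x, degree e x <= 3.
    (* Otherwise 4n <= 2m <= 2(2n - 1). That [A] is nonempty gives n > 0, so the truncated
       subtraction is exact. *)
    apply/existsP; apply: contraT; rewrite negb_exists => /forallP all4.
    have T0 : 0 < #|T| by rewrite -cardsT -AT card_gt0.
    have := sum_degree_le eI.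
    have : \sum_(x : T) 4 <= \sum_x degree e x.
      by apply: leq_sum => x _; rewrite ltnNge.
    have -> : \sum_(x : T) 4 = #|T| * 4 by rewrite sum_nat_const.
    move: edges T0; clear; lia.
  exists x; first by rewrite AT inE.
  apply: leq_trans dx; apply: subset_leq_card; apply/subsetP => z.
  by rewrite !inE => /andP [].
have [u uA] := set0Pn _ A0.
have [v vA] : exists v, v \notin A.
  apply/existsP; rewrite -negb_forall; apply: contra nAT => /forallP F.
  by apply/eqP/setP => z; rewrite F inE.
(* Connectedness gives an edge leaving the proper subset [A]; its end in [A] loses a neighbour, so
   at most three remain. *)
have [x [y [xA yA exy]]] : exists x y, [/\ x \in A, y \notin A & e x y].
  have [p pp vE] := connectP (con u v); elim: p u uA pp vE => [|w p IH] u uA /=.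
    by move=> _ vE; rewrite vE uA in vA.
  case/andP=> euw pp vE; have [wA|wA] := boolP (w \in A); first exact: (IH w).
  by exists u, w.
exists x => //; rewrite -ltnS; apply: leq_trans (deg4 x); apply: proper_card.
apply/properP; split; first by apply/subsetP => z; rewrite !inE => /andP [].
by exists y; rewrite !inE ?exy // /induced (negPf yA) !andbF.
Qed.
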